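(* For every $\mathrm{FO}^{2+}[\mathfrak{B}_0]$ formula $\varphi(x)$ with one free variable $x$ there is a $\mathrm{UTL}^+$ formula $\psi$ such that for every word $u$ and position $i$ of $u$, $(u,[x\mapsto i])\models\varphi$ iff $u,i\models\psi$; and conversely, for every $\mathrm{UTL}^+$ formula $\psi$ there is an $\mathrm{FO}^{2+}[\mathfrak{B}_0]$ formula $\varphi(x)$ with one free variable with the same property. In other words, $\mathrm{FO}^{2+}[\mathfrak{B}_0]$ formulas with one free variable and $\mathrm{UTL}^+$ formulas describe the same languages.
   Context: Let $\Sigma$ be a finite set of unary predicates, alphabet $A=2^\Sigma$, words $u=u_0\cdots u_{m-1}$. $\mathfrak{B}_0=\{\le,<,\mathrm{succ},\mathrm{nsucc}\}$ (with $=$ and $\neq$ also available), interpreted on positions, $\mathrm{succ}(x,y)$ iff $y=x+1$, $\mathrm{nsucc}(x,y)$ iff $y\ne x+1$. $\mathrm{FO}^{2+}[\mathfrak{B}_0]$ is the set of first-order formulas built from $\bot,\top$, atoms $\beta(x,y)$ with $\beta\in\mathfrak{B}_0$ (or $=,\ne$), atoms $a(x)$ with $a\in\Sigma$ (true iff $a$ belongs to the letter at position $x$), $\wedge,\vee,\exists,\forall$, without negation, and using only two distinct variable names (reusable). $\mathrm{UTL}^+$ has grammar $\varphi,\psi::=\bot\mid\top\mid a\mid\varphi\wedge\psi\mid\varphi\vee\psi\mid\mathrm{X}\varphi\mid\mathrm{Y}\varphi\mid\mathrm{P}\varphi\mid\mathrm{F}\varphi\mid\mathrm{H}\varphi\mid\mathrm{G}\varphi$,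 evaluated at a position $i$ of $u$: $u,i\models a$ iff $a\in u_i$; $u,i\models\mathrm{X}\varphi$ iff $i+1<m$ and $u,i+1\models\varphi$; $u,i\models\mathrm{Y}\varphi$ iff $i\ge1$ and $u,i-1\models\varphi$; $\mathrm{F}\varphi$ (resp. $\mathrm{P}\varphi$) holds iff $\varphi$ holds at some position $j>i$ (resp. $j<i$); $\mathrm{G}\varphi$ (resp. $\mathrm{H}\varphi$) holds iff $\varphi$ holds at all positions $j>i$ (resp. $j<i$). *)

(* Defs.v *)
From HB Require Import structures.
From mathcomp Require Import all_boot.
Set Implicit Arguments.
Unset Strict Implicit.
Unset Printing Implicit Defensive.

(* The two reusable variable names. *)
Definition fovar := bool.

Inductive binpred := Le | Lt | Succ | Nsucc | Eq | Neq.

Definition binpred_holds (b : binpred) (i j : nat) : bool :=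
  match b with
  | Le => i <= j
  | Lt => i < j
  | Succ => j == i.+1
  | Nsucc => j != i.+1
  | Eq => i == j
  | Neq => i != j
  end.

Section Logics.

Variable Sigma : finType.

Inductive fo2p :=
  | FBot
  | FTop
  | FBin (b : binpred) (z t : fovar)
  | FLetter (a : Sigma) (z : fovar)
  | FAnd (phi psi : fo2p)
  | FOr (phi psi : fo2p)
  | FEx (z : fovar) (phi : fo2p)
  | FAll (z : fovar) (phi : fo2p).

Fixpoint free_vars (phi : fo2p) : {set fovar} :=
  match phi with
  | FBot | FTop => set0
  | FBin _ z t => [set z; t]
  | FLetter _ z => [set z]
  | FAnd phi1 phi2 | FOr phi1 phi2 => free_vars phi1 :|: free_vars phi2
  | FEx z phi1 | FAll z phi1 => free_vars phi1 :\ z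
  end.

Definition upd (m : nat) (v : fovar -> 'I_m) (z : fovar) (i : 'I_m) :
    fovar -> 'I_m :=
  fun t => if t == z then i else v t.

(* Valuations are total; the value of a variable that is not free in phi is
   irrelevant. *)
Fixpoint fo2p_sat (m : nat) (u : m.-tuple {set Sigma}) (v : fovar -> 'I_m)
    (phi : fo2p) : Prop :=
  match phi with
  | FBot => False
  | FTop => True
  | FBin b z t => binpred_holds b (v z) (v t)
  | FLetter a z => a \in tnth u (v z)
  | FAnd phi1 phi2 => fo2p_sat u v phi1 /\ fo2p_sat u v phi2
  | FOr phi1 phi2 => fo2p_sat u v phi1 \/ fo2p_sat u v phi2
  | FEx z phi1 => exists i : 'I_m, fo2p_sat u (upd v z i) phi1
  | FAll z phi1 => forall i : 'I_m, fo2p_sat u (upd v z i) phi1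
  end.

Inductive utlp :=
  | UBot
  | UTop
  | ULetter (a : Sigma)
  | UAnd (phi psi : utlp)
  | UOr (phi psi : utlp)
  | UX (phi : utlp)
  | UY (phi : utlp)
  | UP (phi : utlp)
  | UF (phi : utlp)
  | UH (phi : utlp)
  | UG (phi : utlp).

Fixpoint utlp_sat (m : nat) (u : m.-tuple {set Sigma}) (i : 'I_m)
    (psi : utlp) : Prop :=
  match psi with
  | UBot => False
  | UTop => True
  | ULetter a => a \in tnth u i
  | UAnd psi1 psi2 => utlp_sat u i psi1 /\ utlp_sat u i psi2
  | UOr psi1 psi2 => utlp_sat u i psi1 \/ utlp_sat u i psi2
  | UX psi1 => exists j : 'I_m, nat_of_ord j = i.+1 /\ utlp_sat u j psi1
  | UY psi1 => exists j : 'I_m, nat_of_ord i = j.+1 /\ utlp_sat u j psi1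
  | UP psi1 => exists j : 'I_m, j < i /\ utlp_sat u j psi1
  | UF psi1 => exists j : 'I_m, i < j /\ utlp_sat u j psi1
  | UH psi1 => forall j : 'I_m, j < i -> utlp_sat u j psi1
  | UG psi1 => forall j : 'I_m, i < j -> utlp_sat u j psi1
  end.

(* phi(x) and psi hold at the same positions of the same words; the assignment
   [x |-> i] is any valuation sending x to i. *)
Definition same_pointed_words (x : fovar) (phi : fo2p) (psi : utlp) : Prop :=
  forall (m : nat) (u : m.-tuple {set Sigma}) (i : 'I_m) (v : fovar -> 'I_m),
    v x = i -> (fo2p_sat u v phi <-> utlp_sat u i psi).

End Logics.

Arguments FBot {Sigma}.
Arguments FTop {Sigma}.
Arguments FBin {Sigma} b z t.
Arguments UBot {Sigma}.
Arguments UTop {Sigma}.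

(* Main.v *)
Require Import Defs.
From mathcomp Require Import all_boot.
From mathcomp Require Import zify.

(** From FO to UTL: once the relative placement of the two positions is fixed
    (equal, or before/after, adjacent or not), every binary atom is constant, so
    a two-variable formula becomes a finite disjunction of products
    [alpha_k(x) /\ beta_k(y)] of UTL formulas. An existential quantifier over
    [y] then distributes over the disjunction. For a universal one, let [S] be
    the set of the [k] such that [alpha_k] holds at [x]: the formula says that,
    for some [S], all [alpha_k] with [k] in [S] hold at [x] and the disjunction
    of the [beta_k] with [k] in [S] holds at all admissible [y]. Both
    "some position placed so" and "all positions placed so" are expressible
    without negation, since [G bot] and [H bot] define the ends of the word. *)

Set Implicit Arguments.
Unset Strict Implicit.
Unset Printing Implicit Defensive.

(** * Relative placements of two positions *)

(* [None] means that the positions are equal; in [Some (after, far)], [after]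
   tells whether the second one is to the right, [far] whether it is not
   adjacent. *)
Definition placement : finType := option (bool * bool).

Definition placed (c : placement) (i j : nat) : bool :=
  match c with
  | None => i == j
  | Some (true, true) => i.+1 < j
  | Some (true, false) => j == i.+1
  | Some (false, true) => j.+1 < i
  | Some (false, false) => i == j.+1
  end.

Definition converse (c : placement) : placement :=
  if c is Some (b, far) then Some (~~ b, far) else None.

Lemma placed_converse c i j : placed (converse c) i j = placed c j i.
Proof. by case: c => [[[][]]|] //=; rewrite eq_sym. Qed.

Lemma placed_total (i j : nat) : exists c, placed c i j.
Proof.
case: (ltngtP i j) => [lt_ij|lt_ji|->]; last by exists None => /=.
- by case: (ltnP i.+1 j) => ?; [exists (Some (true, true)) |
    exists (Some (true, false)) => /=; lia].
- by case: (ltnP j.+1 i) => ?; [exists (Some (false, true)) |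
    exists (Some (false, false)) => /=; lia].
Qed.

(** The atoms depend only on the sign of [j - i] and on whether [j = i + 1], both of which a
    placement fixes. *)
Lemma binpred_placed (b : binpred) (c : placement) :
  exists e : bool, forall i j, placed c i j -> binpred_holds b i j = e.
Proof.
case: b; case: c => [[[][]]|]; first
  [ by exists true => i j /=; lia | by exists false => i j /=; lia ].
Qed.

Lemma binpred_diag (b : binpred) :
  exists e : bool, forall i, binpred_holds b i i = e.
Proof.
case: b; first [ by exists true => i /=; lia | by exists false => i /=; lia ].
Qed.

Section Translation.

Variable Sigma : finType.
Implicit Types (phi : fo2p Sigma) (psi : utlp Sigma).

(** * Valuations and truth values *)

Lemma upd_id m (v : fovar -> 'I_m) z i : upd v z i z = i.
Proof. by rewrite /upd eqxx. Qed.

Lemma upd_negb m (v : fovar -> 'I_m) z i : upd v z i (~~ z) = v (~~ z).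
Proof. by case: z. Qed.

Lemma upd_by_negb m (v : fovar -> 'I_m) z i : upd v (~~ z) i z = v z.
Proof. by case: z. Qed.

Lemma fo2p_sat_free m (u : m.-tuple {set Sigma}) phi v w :
  {in free_vars phi, v =1 w} -> (fo2p_sat u v phi <-> fo2p_sat u w phi).
Proof.
have upd_eq z (A : {set fovar}) (v1 w1 : fovar -> 'I_m) i :
    {in A :\ z, v1 =1 w1} -> {in A, upd v1 z i =1 upd w1 z i}.
  move=> e t tA; rewrite /upd; case: eqP => // /eqP tz.
  by apply: e; rewrite in_setD1 tz.
elim: phi v w => //=.
- by move=> b z t v w e; rewrite !e // !inE eqxx ?orbT.
- by move=> a z v w e; rewrite e // inE.
- move=> p1 IH1 p2 IH2 v w e.
  rewrite (IH1 v w) ?(IH2 v w) // => t tA; apply: e; rewrite inE tA ?orbT //.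
- move=> p1 IH1 p2 IH2 v w e.
  rewrite (IH1 v w) ?(IH2 v w) // => t tA; apply: e; rewrite inE tA ?orbT //.
- move=> z p IH v w e; have IHi i := IH _ _ (upd_eq _ _ _ _ i e).
  by split=> -[i /IHi]; exists i.
- move=> z p IH v w e; have IHi i := IH _ _ (upd_eq _ _ _ _ i e).
  by split=> h i; apply/IHi.
Qed.

(** Positions form a finite type, so the quantifiers in the semantics are decidable. This allows,
    without classical axioms, collecting the indices whose formulas hold at a position. *)
Lemma utlp_sat_bool m (u : m.-tuple {set Sigma}) psi i :
  exists b : bool, utlp_sat u i psi <-> b.
Proof.
have exb (P Q : 'I_m -> Prop) (p : pred 'I_m) :
    (forall j, P j <-> p j) -> (forall j, exists b : bool, Q j <-> b) ->
    exists b : bool, (exists j, P j /\ Q j) <-> b.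
  move=> Pp /fin_all_exists [f Qf]; exists [exists j, p j && f j]; split.
    by case=> j [/Pp pj /Qf fj]; apply/existsP; exists j; rewrite pj.
  by case/existsP=> j /andP[/Pp ? /Qf ?]; exists j.
have allb (p : pred 'I_m) (Q : 'I_m -> Prop) :
    (forall j, exists b : bool, Q j <-> b) ->
    exists b : bool, (forall j, p j -> Q j) <-> b.
  move=> /fin_all_exists [f Qf]; exists [forall j, p j ==> f j]; split.
    by move=> h; apply/forallP=> j; apply/implyP=> /h/Qf.
  by move=> /forallP h j pj; apply/Qf; move/implyP: (h j); apply.
elim: psi i => /=.
- by exists false.
- by exists true.
- by move=> a i; exists (a \in tnth u i).
- move=> p IHp q IHq i; have [b pb] := IHp i; have [b' qb'] := IHq i.
  by exists (b && b'); rewrite pb qb'; split=> /andP.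
- move=> p IHp q IHq i; have [b pb] := IHp i; have [b' qb'] := IHq i.
  by exists (b || b'); rewrite pb qb'; split=> /orP.
- move=> p IHp i; apply: (exb _ _ (fun j => j == i.+1 :> nat)) => // j.
  by split=> /eqP.
- move=> p IHp i; apply: (exb _ _ (fun j => i == j.+1 :> nat)) => // j.
  by split=> /eqP.
- by move=> p IHp i; apply: (exb _ _ (fun j : 'I_m => j < i)).
- by move=> p IHp i; apply: (exb _ _ (fun j : 'I_m => i < j)).
- by move=> p IHp i; apply: (allb (fun j : 'I_m => j < i)).
- by move=> p IHp i; apply: (allb (fun j : 'I_m => i < j)).
Qed.

(** * Finite connectives and modalities relative to a placement *)

Definition uor (K : finType) (S : {set K}) (f : K -> utlp Sigma) :=
  foldr (fun k => UOr (f k)) UBot (enum S).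

Definition uand (K : finType) (S : {set K}) (f : K -> utlp Sigma) :=
  foldr (fun k => UAnd (f k)) UTop (enum S).

Lemma uor_sat m (u : m.-tuple {set Sigma}) i (K : finType) (S : {set K}) f :
  utlp_sat u i (uor S f) <-> exists2 k, k \in S & utlp_sat u i (f k).
Proof.
suff -> : utlp_sat u i (uor S f) <->
    exists2 k, k \in enum S & utlp_sat u i (f k).
  by split=> -[k kS fk]; exists k; rewrite ?mem_enum // -mem_enum.
rewrite /uor; elim: (enum S) => [|k s IH] /=; first by split=> // -[].
rewrite IH; split=> [[fk|[l ls fl]]|[l]].
- by exists k; rewrite ?mem_head.
- by exists l; rewrite // inE ls orbT.
- by rewrite inE => /predU1P[->|ls fl]; [left | right; exists l].
Qed.

Lemma uand_sat m (u : m.-tuple {set Sigma}) i (K : finType) (S : {set K}) f :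
  utlp_sat u i (uand S f) <-> forall k, k \in S -> utlp_sat u i (f k).
Proof.
suff -> : utlp_sat u i (uand S f) <->
    forall k, k \in enum S -> utlp_sat u i (f k).
  by split=> h k kS; apply: h; rewrite ?mem_enum // -mem_enum.
rewrite /uand; elim: (enum S) => [|k s IH] /=; first by split.
rewrite IH; split=> [[fk h] l|h].
  by rewrite inE => /predU1P[->|/h].
by split=> [|l ls]; apply: h; rewrite inE ?eqxx // ls orbT.
Qed.

Definition dia (c : placement) psi : utlp Sigma :=
  match c with
  | None => psi
  | Some (true, true) => UX (UF psi)
  | Some (true, false) => UX psi
  | Some (false, true) => UY (UP psi)
  | Some (false, false) => UY psi
  end.

(** [UX] and [UY] assert that a neighbour exists; the disjunct [UG UBot] or [UH UBot] covers the end
    of the word, where no position is so placed. *)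
Definition box (c : placement) psi : utlp Sigma :=
  match c with
  | None => psi
  | Some (true, true) => UOr (UG UBot) (UX (UG psi))
  | Some (true, false) => UOr (UG UBot) (UX psi)
  | Some (false, true) => UOr (UH UBot) (UY (UH psi))
  | Some (false, false) => UOr (UH UBot) (UY psi)
  end.

Lemma last_or_next m (i : 'I_m) :
  (forall j : 'I_m, ~ i < j) \/ exists j : 'I_m, nat_of_ord j = i.+1.
Proof.
case: (ltnP i.+1 m) => [lt_im|le_mi]; first by right; exists (Ordinal lt_im).
by left=> j lt_ij; have := ltn_ord j; lia.
Qed.

Lemma first_or_prev m (i : 'I_m) :
  (forall j : 'I_m, ~ j < i) \/ exists j : 'I_m, nat_of_ord i = j.+1.
Proof.
case: (posnP i) => [i0|i_gt0]; first by left=> j; rewrite i0.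
have lt_im : i.-1 < m by have := ltn_ord i; lia.
by right; exists (Ordinal lt_im); rewrite /= prednK.
Qed.

Lemma dia_sat m (u : m.-tuple {set Sigma}) i c psi :
  utlp_sat u i (dia c psi) <-> exists2 j : 'I_m, placed c i j & utlp_sat u j psi.
Proof.
case: c => [[[][]]|] /=; split.
- by case=> k [ki [j [kj sj]]]; exists j => //; rewrite -ki.
- case=> j lt_ij sj; have lt_im : i.+1 < m by have := ltn_ord j; lia.
  by exists (Ordinal lt_im); split=> //; exists j.
- by case=> j [ji sj]; exists j => //; apply/eqP.
- by case=> j /eqP ji sj; exists j.
- by case=> k [ki [j [kj sj]]]; exists j => //; lia.
- case=> j lt_ji sj; have lt_im : i.-1 < m by have := ltn_ord i; lia.
  by exists (Ordinal lt_im) => /=; split; [lia | exists j; split=> //; lia].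
- by case=> j [ij sj]; exists j => //; apply/eqP.
- by case=> j /eqP ij sj; exists j.
- by exists i.
- by case=> j /eqP/ord_inj ->.
Qed.

Lemma box_sat m (u : m.-tuple {set Sigma}) i c psi :
  utlp_sat u i (box c psi) <-> forall j : 'I_m, placed c i j -> utlp_sat u j psi.
Proof.
case: c => [[[][]]|] /=; split.
- move=> [h j lt_ij|[k [ki h]] j lt_ij]; last by apply: h; rewrite ki.
  by case: (h j); apply: ltnW.
- move=> h; case: (last_or_next i) => [|[k ki]]; first by left.
  by right; exists k; split=> // j; rewrite ki => /h.
- move=> [h j /eqP ji|[k [ki sk]] j /eqP ji]; first by case: (h j); rewrite ji.
  by rewrite (_ : j = k) //; apply: ord_inj; rewrite ki.
- move=> h; case: (last_or_next i) => [|[k ki]]; first by left.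
  by right; exists k; split=> //; apply: h; rewrite ki.
- move=> [h j lt_ji|[k [ik h]] j lt_ji]; last by apply: h; lia.
  by case: (h j); apply: ltnW.
- move=> h; case: (first_or_prev i) => [|[k ik]]; first by left.
  by right; exists k; split=> // j jk; apply: h; rewrite ik.
- move=> [h j /eqP ij|[k [ik sk]] j /eqP ij]; first by case: (h j); rewrite ij.
  by rewrite (_ : j = k) //; apply: ord_inj; lia.
- move=> h; case: (first_or_prev i) => [|[k ik]]; first by left.
  by right; exists k; split=> //; apply: h; rewrite ik.
- by move=> si j /eqP/ord_inj <-.
- by move=> h; apply: h.
Qed.

(** * Separation of the two variables *)

(** The families are chosen before the word, so that one translation serves all words. Here [z] is
    the variable about to be quantified, and [alpha] speaks of the other one. *)
Definition separable_at (z : fovar) (c : placement) phi : Prop :=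
  exists (K : finType) (alpha beta : K -> utlp Sigma),
    forall m (u : m.-tuple {set Sigma}) (v : fovar -> 'I_m),
      placed c (v (~~ z)) (v z) ->
      (fo2p_sat u v phi <->
       exists k, utlp_sat u (v (~~ z)) (alpha k) /\ utlp_sat u (v z) (beta k)).

Definition separable phi : Prop := forall z c, separable_at z c phi.

(** Exchanging the variables amounts to exchanging [alpha] and [beta] and reversing the
    placement. *)
Lemma separableP phi : (forall c, separable_at true c phi) -> separable phi.
Proof.
move=> sep [] c; first exact: sep.
have [K [alpha [beta sat_phi]]] := sep (converse c).
exists K, beta, alpha => m u v placed_v.
rewrite sat_phi /= ?placed_converse //.
by split=> -[k [? ?]]; exists k.
Qed.

(** Besides letters, this handles quantified formulas: once translated, they depend on one variable
    only, and the induction can go on. *)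
Lemma separable_of_unary phi (z : fovar) psi :
  (forall m (u : m.-tuple {set Sigma}) v,
     fo2p_sat u v phi <-> utlp_sat u (v z) psi) ->
  separable phi.
Proof.
move=> sat_phi; apply: separableP => c; exists unit.
exists (fun=> if z then UTop else psi), (fun=> if z then psi else UTop).
move=> m u v _; rewrite sat_phi.
by case: z {sat_phi}; split=> [s|[_ []]] //; exists tt.
Qed.

Lemma separable_const phi (c2e : placement -> bool) :
  (forall m (u : m.-tuple {set Sigma}) (v : fovar -> 'I_m) c,
     placed c (v false) (v true) -> (fo2p_sat u v phi <-> c2e c)) ->
  separable phi.
Proof.
move=> sat_phi; apply: separableP => c.
exists unit, (fun=> if c2e c then UTop else UBot), (fun=> UTop) => m u v pv.
rewrite (sat_phi _ _ _ _ pv); case: (c2e c); split=> //.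
by case=> _ [].
Qed.

Lemma separable_bin b z t : separable (FBin b z t).
Proof.
have [eqzt|neqzt] := eqVneq z t.
  have [e be] := binpred_diag b.
  by apply: (@separable_const _ (fun=> e)) => m u v c _ /=; rewrite eqzt be.
have [f bf] := fin_all_exists (binpred_placed b).
(* [c] leads from variable [false] to variable [true], whereas [f] expects the placement from [z] to
   [t]. *)
apply: (@separable_const _ (fun c => f (if t then c else converse c))).
move=> m u v c pv /=; case: z t neqzt => -[] //= _.
  by rewrite (bf (converse c)) ?placed_converse.
by rewrite (bf c).
Qed.

Lemma separable_or phi1 phi2 :
  separable phi1 -> separable phi2 -> separable (FOr phi1 phi2).
Proof.
move=> sep1 sep2 z c.
have [K1 [a1 [b1 sat1]]] := sep1 z c; have [K2 [a2 [b2 sat2]]] := sep2 z c.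
exists (K1 + K2)%type.
exists (fun k => match k with inl k1 => a1 k1 | inr k2 => a2 k2 end).
exists (fun k => match k with inl k1 => b1 k1 | inr k2 => b2 k2 end).
move=> m u v pv /=; rewrite sat1 // sat2 //; split.
  by case=> -[k s]; [exists (inl k) | exists (inr k)].
by case=> -[k|k] s; [left | right]; exists k.
Qed.

Lemma separable_and phi1 phi2 :
  separable phi1 -> separable phi2 -> separable (FAnd phi1 phi2).
Proof.
move=> sep1 sep2 z c.
have [K1 [a1 [b1 sat1]]] := sep1 z c; have [K2 [a2 [b2 sat2]]] := sep2 z c.
exists (K1 * K2)%type, (fun k => UAnd (a1 k.1) (a2 k.2)),
  (fun k => UAnd (b1 k.1) (b2 k.2)).
move=> m u v pv /=; rewrite sat1 // sat2 //; split.
  by case=> -[k1 [? ?]] [k2 [? ?]]; exists (k1, k2).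
by case=> -[k1 k2] /= [[? ?] [? ?]]; split; [exists k1 | exists k2].
Qed.

(** * Elimination of quantifiers *)

Lemma ex_to_utlp z phi : separable phi ->
  exists psi, forall m (u : m.-tuple {set Sigma}) v,
    fo2p_sat u v (FEx z phi) <-> utlp_sat u (v (~~ z)) psi.
Proof.
move=> sep.
have /fin_all_exists [g gP] c : exists psi,
    forall m (u : m.-tuple {set Sigma}) (v : fovar -> 'I_m),
    (exists2 j : 'I_m, placed c (v (~~ z)) j & fo2p_sat u (upd v z j) phi) <->
    utlp_sat u (v (~~ z)) psi.
  have [K [alpha [beta sat_phi]]] := sep z c.
  exists (uor setT (fun k => UAnd (alpha k) (dia c (beta k)))) => m u v.
  rewrite uor_sat; split.
    case=> j pj /sat_phi; rewrite upd_id upd_negb => /(_ pj) [k [ak bk]].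
    by exists k => //=; split=> //; apply/dia_sat; exists j.
  case=> k _ /= [ak /dia_sat [j pj bk]]; exists j => //.
  by apply/sat_phi; rewrite ?upd_id ?upd_negb //; exists k.
exists (uor setT g) => m u v /=; rewrite uor_sat; split.
  case=> j sj; have [c pc] := placed_total (v (~~ z)) j.
  by exists c => //; apply/gP; exists j.
by case=> c _ /gP [j _ sj]; exists j.
Qed.

Lemma all_to_utlp z phi : separable phi ->
  exists psi, forall m (u : m.-tuple {set Sigma}) v,
    fo2p_sat u v (FAll z phi) <-> utlp_sat u (v (~~ z)) psi.
Proof.
move=> sep.
have /fin_all_exists [g gP] c : exists psi,
    forall m (u : m.-tuple {set Sigma}) (v : fovar -> 'I_m),
    (forall j : 'I_m, placed c (v (~~ z)) j -> fo2p_sat u (upd v z j) phi) <->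
    utlp_sat u (v (~~ z)) psi.
  have [K [alpha [beta sat_phi]]] := sep z c.
  exists (uor [set: {set K}]
    (fun S => UAnd (uand S alpha) (box c (uor S beta)))) => m u v.
  rewrite uor_sat; split.
    move=> h.
    (* The witness is the set of all [k] whose [alpha k] holds at the fixed position; it does not
       depend on [j]. *)
    have /fin_all_exists [e eP] k := utlp_sat_bool u (alpha k) (v (~~ z)).
    exists [set k | e k]; [exact: in_setT | split].
      by apply/uand_sat=> k; rewrite inE => /eP.
    apply/box_sat=> j pj; apply/uor_sat.
    move/sat_phi: (h j pj); rewrite upd_id upd_negb => /(_ pj) [k [/eP ek bk]].
    by exists k; rewrite ?inE.
  (* Conversely any [S] will do: the [k] in [S] found for [j] has its [alpha k] true. *)
  case=> S _ /= [/uand_sat aS /box_sat bS] j pj.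
  apply/sat_phi; rewrite ?upd_id ?upd_negb //.
  by have /uor_sat [k kS bk] := bS j pj; exists k; split=> //; apply: aS.
exists (uand setT g) => m u v /=; rewrite uand_sat; split.
  by move=> h c _; apply/gP.
move=> h j; have [c pc] := placed_total (v (~~ z)) j.
by have /gP := h c (in_setT c); apply.
Qed.

Lemma fo2p_separable phi : separable phi.
Proof.
elim: phi => [||b z t|a z|p IHp q IHq|p IHp q IHq|z p IHp|z p IHp].
- exact: (@separable_of_unary _ true UBot).
- exact: (@separable_of_unary _ true UTop).
- exact: separable_bin.
- exact: (@separable_of_unary _ z (ULetter a)).
- exact: separable_and.
- exact: separable_or.
- by have [psi psiP] := ex_to_utlp z IHp; apply: separable_of_unary psiP.
- by have [psi psiP] := all_to_utlp z IHp; apply: separable_of_unary psiP.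
Qed.

(** Quantifying existentially over the other variable, which is not free in [phi], preserves the
    meaning and reduces the claim to [ex_to_utlp]. *)
Lemma fo2p_to_utlp x phi : free_vars phi \subset [set x] ->
  exists psi, same_pointed_words x phi psi.
Proof.
move=> /subsetP fv_x.
have [psi psiP] := ex_to_utlp (~~ x) (fo2p_separable phi).
exists psi => m u i v <-; have := psiP m u v; rewrite negbK => <- /=.
have sat_upd j : fo2p_sat u v phi <-> fo2p_sat u (upd v (~~ x) j) phi.
  by apply: fo2p_sat_free => t /fv_x /set1P ->; rewrite upd_by_negb.
by split=> [s|[j /sat_upd]] //; exists (v x); apply/sat_upd.
Qed.

(** * From UTL to FO *)

(** Each modality swaps the roles of the two names, so two suffice. The guards of [UH] and [UG]
    would be negated strict inequalities; [Le] with its arguments reversed expresses them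
    positively. *)
Fixpoint utlp_to_fo2p (x : fovar) psi : fo2p Sigma :=
  let y := ~~ x in
  match psi with
  | UBot => FBot
  | UTop => FTop
  | ULetter a => FLetter a x
  | UAnd psi1 psi2 => FAnd (utlp_to_fo2p x psi1) (utlp_to_fo2p x psi2)
  | UOr psi1 psi2 => FOr (utlp_to_fo2p x psi1) (utlp_to_fo2p x psi2)
  | UX psi1 => FEx y (FAnd (FBin Succ x y) (utlp_to_fo2p y psi1))
  | UY psi1 => FEx y (FAnd (FBin Succ y x) (utlp_to_fo2p y psi1))
  | UP psi1 => FEx y (FAnd (FBin Lt y x) (utlp_to_fo2p y psi1))
  | UF psi1 => FEx y (FAnd (FBin Lt x y) (utlp_to_fo2p y psi1))
  | UH psi1 => FAll y (FOr (FBin Le x y) (utlp_to_fo2p y psi1))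
  | UG psi1 => FAll y (FOr (FBin Le y x) (utlp_to_fo2p y psi1))
  end.

Lemma utlp_to_fo2p_free x psi : free_vars (utlp_to_fo2p x psi) \subset [set x].
Proof.
(* Under a modality the body is translated at [~~ x], where the induction hypothesis for [x] says
   nothing; with only two names, removing [~~ x] is enough. *)
have subD (A : {set fovar}) : A :\ ~~ x \subset [set x].
  by apply/subsetP=> t; rewrite !inE => /andP[]; case: x; case: t.
by elim: psi => //= *; rewrite ?sub0set // subUset; apply/andP.
Qed.

Lemma utlp_to_fo2p_sat x psi : same_pointed_words x (utlp_to_fo2p x psi) psi.
Proof.
(* The induction generalizes [x] and [v], since modalities change both. *)
move=> m u i v <- {i}; elim: psi x v => //=.
- by move=> p IHp q IHq x v; rewrite IHp IHq.
- by move=> p IHp q IHq x v; rewrite IHp IHq.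
- move=> p IH x v; split=> -[j] [].
    by rewrite upd_id upd_by_negb IH upd_id => /eqP ? ?; exists j.
  by move=> /eqP ? ?; exists j; rewrite upd_id upd_by_negb IH upd_id.
- move=> p IH x v; split=> -[j] [].
    by rewrite upd_id upd_by_negb IH upd_id => /eqP ? ?; exists j.
  by move=> /eqP ? ?; exists j; rewrite upd_id upd_by_negb IH upd_id.
- move=> p IH x v; split=> -[j] [].
    by rewrite upd_id upd_by_negb IH upd_id => ? ?; exists j.
  by move=> ? ?; exists j; rewrite upd_id upd_by_negb IH upd_id.
- move=> p IH x v; split=> -[j] [].
    by rewrite upd_id upd_by_negb IH upd_id => ? ?; exists j.
  by move=> ? ?; exists j; rewrite upd_id upd_by_negb IH upd_id.
- move=> p IH x v; split=> h j; last first.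
    by rewrite upd_id upd_by_negb IH upd_id; case: leqP => [_|/h]; [left|right].
  by case: (h j); rewrite ?IH upd_id ?upd_by_negb // leqNgt => /negbTE ->.
- move=> p IH x v; split=> h j; last first.
    by rewrite upd_id upd_by_negb IH upd_id; case: leqP => [_|/h]; [left|right].
  by case: (h j); rewrite ?IH upd_id ?upd_by_negb // leqNgt => /negbTE ->.
Qed.

End Translation.

Theorem theorem26 (Sigma : finType) (x : fovar) :
  (forall phi : fo2p Sigma, free_vars phi \subset [set x] ->
     exists psi : utlp Sigma, same_pointed_words x phi psi) /\
  (forall psi : utlp Sigma,
     exists phi : fo2p Sigma,
       free_vars phi \subset [set x] /\ same_pointed_words x phi psi).
Proof.
split=> [phi|psi]; first exact: fo2p_to_utlp.
exists (utlp_to_fo2p x psi); split; first exact: utlp_to_fo2p_free.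
exact: utlp_to_fo2p_sat.
Qed.
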